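(* The following hold. (1) Every subgroup of a TNA topological group is TNA; every quotient group of a TNA topological group by a closed normal subgroup is TNA; and the direct product (with the product topology) of any family of TNA topological groups is TNA. (2) Every subgroup of a topological group with SMOG has SMOG, and the direct product (with the product topology) of any family of topological groups with SMOG has SMOG. On the other hand, SMOG is not always inherited by quotients: there exist a topological group $G$ with SMOG and a closed normal subgroup $N$ of $G$ such that $G/N$ does not have SMOG. (3) Every quotient group of a TA topological group by a closed normal subgroup is TA, and the direct product (with the product topology) of any family of TA topological groups is TA. On the other hand, subgroups of TA groups need not be TA: there exist a TA topological group $G$ and a subgroup $H$ of $G$ such that $H$ is not TA.
   Context: All topological groups are assumed to be Hausdorff. Subgroups carry the subspace topology and quotients the quotient topology; quotients are always taken by closed subgroups. A topological group is topologically non-Archimedean (TNA) if every neighborhood of the neutral element contains an open subgroup. A topological group has sufficiently many open subgroups (SMOG) if the intersection of all its open subgroups consists of only the neutral element. A topological group is topologically Archimedean (TA) if it has no proper open subgroups. *)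

(* Defs.v *)
From HB Require Import structures.
From mathcomp Require Import all_boot.
From mathcomp Require Import all_classical topology.

Set Implicit Arguments.
Unset Strict Implicit.
Unset Printing Implicit Defensive.

Local Open Scope classical_set_scope.
Local Open Scope group_scope.
Local Open Scope quotient_scope.

HB.structure Definition PreTopologicalGroup := {G of Group G & Topological G}.

HB.mixin Record PreTopologicalGroup_isTopologicalGroup G
    & PreTopologicalGroup G := {
  mulg_continuous : continuous (fun x : G * G => x.1 * x.2) ;
  invg_continuous : continuous (fun x : G => x^-1) ;
  topgroup_hausdorff : hausdorff_space G ;
}.

#[short(type="topologicalGroupType")]
HB.structure Definition TopologicalGroup :=
  {G of PreTopologicalGroup G & PreTopologicalGroup_isTopologicalGroup G}.

Record subgroup (G : groupType) := Subgroup {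
  subgroup_set :> set G ;
  subgroup_group_closed : group_closed [in subgroup_set] ;
}.

Record closed_normal_subgroup (G : topologicalGroupType) :=
  ClosedNormalSubgroup {
  cns_subgroup :> subgroup G ;
  cns_normal : forall x y : G, x \in (cns_subgroup : set G) ->
    x ^ y \in (cns_subgroup : set G) ;
  cns_closed : closed cns_subgroup ;
}.

Section SubgroupTheory.
Context {G : groupType} (H : subgroup G).
Local Notation H' := (subgroup_set H).

Lemma subgroup1 : 1 \in H'.
Proof. by have [] := subgroup_group_closed H. Qed.

Lemma subgroupF x y : x \in H' -> y \in H' -> x / y \in H'.
Proof. by have [_] := subgroup_group_closed H; apply. Qed.

Lemma subgroupV x : x \in H' -> x^-1 \in H'.
Proof. exact: group_closedV (subgroup_group_closed H) _. Qed.

Lemma subgroupM x y : x \in H' -> y \in H' -> x * y \in H'.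
Proof. exact: group_closedM (subgroup_group_closed H) _ _. Qed.

End SubgroupTheory.

Definition subgroup_type {G : groupType} (H : subgroup G) : Type := set_type H.

HB.instance Definition _ (G : groupType) (H : subgroup G) :=
  SubChoice.on (subgroup_type H).
HB.instance Definition _ (G : groupType) (H : subgroup G) :=
  SubChoice_isSubGroup.Build G [in (H : set G)] (subgroup_type H)
    (subgroup_group_closed H).
HB.instance Definition _ (G : topologicalGroupType) (H : subgroup G) :=
  Topological.copy (subgroup_type H) (set_type H).

Section SubgroupTopology.
Context {G : topologicalGroupType} (H : subgroup G).
Local Notation sH := (subgroup_type H).

Let val_cts : continuous (val : sH -> G).
Proof. exact: initial_continuous. Qed.

Fact subgroup_mulg_continuous : continuous (fun x : sH * sH => x.1 * x.2).
Proof.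
apply: (@continuous_comp_initial _ _ _ (set_val : set_type H -> G)) => -[x y].
apply: (@continuous_comp _ _ _ (fun z : sH * sH => (val z.1, val z.2))
  (fun z : G * G => z.1 * z.2)); last exact: mulg_continuous.
by apply: cvg_pair; (apply: cvg_comp; last exact: val_cts);
  [exact: cvg_fst|exact: cvg_snd].
Qed.

Fact subgroup_invg_continuous : continuous (fun x : sH => x^-1).
Proof.
apply: (@continuous_comp_initial _ _ _ (set_val : set_type H -> G)) => x.
apply: (@continuous_comp sH G G val (fun z : G => z^-1)).
  exact: val_cts.
exact: invg_continuous.
Qed.

Fact subgroup_hausdorff : hausdorff_space sH.
Proof.
move=> p q pq; apply: val_inj; apply: (@topgroup_hausdorff G) => A B nA nB.
have [r [Ar Br]] := pq _ _ (val_cts nA) (val_cts nB).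
by exists (val r).
Qed.

HB.instance Definition _ :=
  PreTopologicalGroup_isTopologicalGroup.Build (subgroup_type H)
    subgroup_mulg_continuous subgroup_invg_continuous subgroup_hausdorff.

End SubgroupTopology.

Section Quotient.
Context {G : topologicalGroupType} (N : closed_normal_subgroup G).
Local Notation N' := (subgroup_set N).

Definition coset_eq (x y : G) : bool := x^-1 * y \in N'.

Fact coset_eq_refl : reflexive coset_eq.
Proof. by move=> x; rewrite /coset_eq mulVg subgroup1. Qed.

Fact coset_eq_sym : symmetric coset_eq.
Proof.
by move=> x y; rewrite /coset_eq; apply/idP/idP => /subgroupV;
  rewrite invgM invgK.
Qed.

Fact coset_eq_trans : transitive coset_eq.
Proof.
move=> y x z; rewrite /coset_eq => xy yz.
by have := subgroupM xy yz; rewrite -mulgA mulVKg.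
Qed.

Canonical coset_equiv := EquivRel coset_eq
  coset_eq_refl coset_eq_sym coset_eq_trans.

Definition quotient_group : Type := quotient_topology {eq_quot coset_eq}.

HB.instance Definition _ := Topological.on quotient_group.
HB.instance Definition _ := Quotient.on quotient_group.

Local Notation Q := quotient_group.

Fact quotientP x y : reflect (\pi_Q x = \pi_Q y) (coset_eq x y).
Proof. exact: eqmodP. Qed.

Fact quotient_ind (P : Q -> Prop) : (forall x, P (\pi_Q x)) -> forall p, P p.
Proof. exact: quotW. Qed.

Fact coset_eqV x y : coset_eq x y -> coset_eq x^-1 y^-1.
Proof.
rewrite coset_eq_sym /coset_eq => /(@cns_normal _ N _ y^-1).
by rewrite conjgE !invgK mulgA mulVKg.
Qed.

Fact coset_eqM x x' y y' :
  coset_eq x x' -> coset_eq y y' -> coset_eq (x * y) (x' * y').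
Proof.
rewrite /coset_eq => /(@cns_normal _ N _ y) xx' yy'.
have := subgroupM xx' yy'.
by rewrite conjgE -!mulgA mulVKg invgM -!mulgA.
Qed.

Definition quotient_one : Q := \pi_Q 1.
Definition quotient_inv (p : Q) : Q := \pi_Q (repr p)^-1.
Definition quotient_mul (p q : Q) : Q := \pi_Q (repr p * repr q).

Fact pi_invg x : quotient_inv (\pi_Q x) = \pi_Q x^-1.
Proof.
by apply/esym/quotientP; case: piP => y /quotientP; exact: coset_eqV.
Qed.

Fact pi_mulg x y : quotient_mul (\pi_Q x) (\pi_Q y) = \pi_Q (x * y).
Proof.
apply/esym/quotientP; rewrite /quotient_mul.
by case: piP => x' /quotientP xx'; case: piP => y' /quotientP; exact: coset_eqM.
Qed.

Fact quotient_mulA : associative quotient_mul.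
Proof.
move=> p q r; elim/quotient_ind: p => x; elim/quotient_ind: q => y; elim/quotient_ind: r => z.
by rewrite !pi_mulg mulgA.
Qed.

Fact quotient_mul1g : left_id quotient_one quotient_mul.
Proof. by move=> p; elim/quotient_ind: p => x; rewrite pi_mulg mul1g. Qed.

Fact quotient_mulg1 : right_id quotient_one quotient_mul.
Proof. by move=> p; elim/quotient_ind: p => x; rewrite pi_mulg mulg1. Qed.

Fact quotient_mulVg : left_inverse quotient_one quotient_inv quotient_mul.
Proof. by move=> p; elim/quotient_ind: p => x; rewrite pi_invg pi_mulg mulVg. Qed.

Fact quotient_mulgV : right_inverse quotient_one quotient_inv quotient_mul.
Proof. by move=> p; elim/quotient_ind: p => x; rewrite pi_invg pi_mulg mulgV. Qed.

HB.instance Definition _ := isGroup.Build quotient_group quotient_mulA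
  quotient_mul1g quotient_mulg1 quotient_mulVg quotient_mulgV.

Fact quotient_pi_continuous : continuous (\pi_Q : G -> Q).
Proof. exact: pi_continuous. Qed.

Fact quotient_pi_nbhs (x : G) (A : set G) :
  nbhs x A -> nbhs (\pi_Q x) (\pi_Q @` A).
Proof.
rewrite nbhsE => -[V [oV Vx] VA].
have sVA : \pi_Q @` V `<=` \pi_Q @` A by exact: image_subset.
apply: (filterS sVA).
apply: open_nbhs_nbhs; split; last by exists x.
suff : open (\pi_Q @^-1` (\pi_Q @` V)) by [].
rewrite openE => y [v Vv /quotientP vy]; rewrite /interior.
have cts : continuous (fun z : G => z * (v^-1 * y)^-1).
  move=> z; apply: (@continuous_comp G (G * G)%type G
    (fun z => (z, (v^-1 * y)^-1)) (fun z => z.1 * z.2)).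
    by apply: cvg_pair; [exact: cvg_id|exact: cvg_cst].
  exact: mulg_continuous.
have nV : nbhs y [set z | V (z * (v^-1 * y)^-1)].
  by apply: cts; rewrite invgM invgK mulVKg; exact: open_nbhs_nbhs.
apply: (filterS _ nV) => z Vz; exists (z * (v^-1 * y)^-1) => //.
by apply/quotientP; rewrite /coset_eq invgM invgK -mulgA mulVg mulg1.
Qed.

Fact quotient_mulg_continuous : continuous (fun x : Q * Q => x.1 * x.2).
Proof.
move=> [p q]; elim/quotient_ind: p => x; elim/quotient_ind: q => y U /=.
rewrite [_ * _]pi_mulg => /quotient_pi_continuous.
move=> /(@mulg_continuous G (x, y)) [[A B] [/= nA nB] ABU].
exists (\pi_Q @` A, \pi_Q @` B); first by split; exact: quotient_pi_nbhs.
move=> [_ _] /= [[a Aa <-] [b Bb <-]]; rewrite [_ * _]pi_mulg.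
exact: (ABU (a, b)).
Qed.

Fact quotient_invg_continuous : continuous (fun x : Q => x^-1).
Proof.
move=> p; elim/quotient_ind: p => x U /=; rewrite [_^-1]pi_invg => /quotient_pi_continuous.
move=> /(@invg_continuous G x) /quotient_pi_nbhs; apply: filterS.
by move=> _ [y Uy <-] /=; rewrite [_^-1]pi_invg.
Qed.

Fact quotient_hausdorff : hausdorff_space Q.
Proof.
move=> p q; elim/quotient_ind: p => x; elim/quotient_ind: q => y xy; apply/quotientP; apply: contrapT => nxy.
have cts : {for (x, y), continuous (fun z : G * G => z.1^-1 * z.2)}.
  apply: (@continuous_comp (G * G)%type (G * G)%type G
    (fun z => (z.1^-1, z.2)) (fun z => z.1 * z.2)); last exact: mulg_continuous.
  apply: cvg_pair; last exact: cvg_snd.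
  by apply: cvg_comp; [exact: cvg_fst|exact: invg_continuous].
have /cts [[A B] [/= nA nB] AB] : nbhs (x^-1 * y) (~` N').
  apply: open_nbhs_nbhs; split; first exact/closed_openC/cns_closed.
  by move=> Nxy; apply: nxy; apply/mem_set.
have [_ [[a Aa <-] [b Bb /esym /quotientP]]] :=
  xy _ _ (quotient_pi_nbhs nA) (quotient_pi_nbhs nB).
by move=> /set_mem; exact: (AB (a, b)).
Qed.

HB.instance Definition _ :=
  PreTopologicalGroup_isTopologicalGroup.Build quotient_group
    quotient_mulg_continuous quotient_invg_continuous quotient_hausdorff.

End Quotient.

Section ProductGroup.
Context {I : Type} (K : I -> topologicalGroupType).
Local Notation P := (prod_topology K).

Definition prod_one : P := fun i => 1.
Definition prod_inv (f : P) : P := fun i => (f i)^-1.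
Definition prod_mul (f g : P) : P := fun i => f i * g i.

Fact prod_mulA : associative prod_mul.
Proof. by move=> f g h; apply: functional_extensionality_dep => i; exact: mulgA.
Qed.

Fact prod_mul1g : left_id prod_one prod_mul.
Proof. by move=> f; apply: functional_extensionality_dep => i; exact: mul1g.
Qed.

Fact prod_mulg1 : right_id prod_one prod_mul.
Proof. by move=> f; apply: functional_extensionality_dep => i; exact: mulg1.
Qed.

Fact prod_mulVg : left_inverse prod_one prod_inv prod_mul.
Proof. by move=> f; apply: functional_extensionality_dep => i; exact: mulVg.
Qed.

Fact prod_mulgV : right_inverse prod_one prod_inv prod_mul.
Proof. by move=> f; apply: functional_extensionality_dep => i; exact: mulgV.
Qed.

HB.instance Definition _ := isGroup.Build P prod_mulA
  prod_mul1g prod_mulg1 prod_mulVg prod_mulgV.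


(* proj_continuous of the library asks for an eqType of indices. *)
Fact prod_proj_continuous i : continuous (fun f : P => f i).
Proof.
move=> f U fU.
have /cvg_sup/(_ i) : nbhs f --> (f : P) by exact: cvg_id.
apply; exact: (@initial_continuous _ _ (fun f : forall i, K i => f i)).
Qed.

Fact prod_topology_continuous (T : topologicalType) (f : T -> P) :
  (forall i, continuous (fun x => f x i)) -> continuous f.
Proof.
move=> cf x; apply/cvg_sup => i U [_] [[B oB <-]] Bfx BU.
have fB : nbhs x [set z | B (f z i)] by apply: cf; exact: open_nbhs_nbhs.
by apply: filterS fB => z; exact: BU.
Qed.

Fact prod_mulg_continuous : continuous (fun x : P * P => x.1 * x.2).
Proof.
apply: prod_topology_continuous => i x.
apply: (@continuous_comp (P * P)%type (K i * K i)%type (K i)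
  (fun z => (z.1 i, z.2 i)) (fun z => z.1 * z.2)); last exact: mulg_continuous.
apply: cvg_pair.
  apply: (@continuous_comp _ P (K i) fst (fun z => z i)); first exact: cvg_fst.
  exact: prod_proj_continuous.
apply: (@continuous_comp _ P (K i) snd (fun z => z i)); first exact: cvg_snd.
exact: prod_proj_continuous.
Qed.

Fact prod_invg_continuous : continuous (fun x : P => x^-1).
Proof.
apply: prod_topology_continuous => i x.
apply: (@continuous_comp P (K i) (K i) (fun z => z i) (fun z => z^-1)).
  exact: prod_proj_continuous.
exact: invg_continuous.
Qed.

Fact prod_hausdorff : hausdorff_space P.
Proof.
move=> f g fg; apply: functional_extensionality_dep => i.
apply: topgroup_hausdorff => A B nA nB.
have [h [Ah Bh]] := fg _ _ (prod_proj_continuous nA) (prod_proj_continuous nB).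
by exists (h i).
Qed.

HB.instance Definition _ :=
  PreTopologicalGroup_isTopologicalGroup.Build P
    prod_mulg_continuous prod_invg_continuous prod_hausdorff.

End ProductGroup.

Section OpenSubgroups.
Variable G : topologicalGroupType.

(* topologically non-Archimedean *)
Definition TNA : Prop :=
  forall U : set G, nbhs 1 U ->
    exists H : subgroup G, open (H : set G) /\ (H : set G) `<=` U.

(* sufficiently many open subgroups *)
Definition SMOG : Prop :=
  \bigcap_(H in [set H : subgroup G | open (H : set G)]) (H : set G) = [set 1].

(* topologically Archimedean *)
Definition TA : Prop :=
  ~ exists H : subgroup G, open (H : set G) /\ (H : set G) `<` setT.

End OpenSubgroups.

(* Main.v *)
Require Import Defs.
From HB Require Import structures.
From mathcomp Require Import all_boot all_order all_algebra.
From mathcomp Require Import all_classical topology.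

(** All three permanence statements come from transporting open subgroups along
continuous homomorphisms.  Preimages of open subgroups are open subgroups, so
SMOG passes to any group that homomorphisms into SMOG groups separate
([SMOG_separated]), TA passes to continuous images ([TA_image]), and TNA passes
to any group carrying the initial topology of homomorphisms into TNA groups
([TNA_initial]).  Images under open homomorphisms are open as well, which gives
TNA for quotients ([TNA_open_image]).  The one case outside this pattern is a
product of TA groups ([TA_prod]): an open subgroup contains all elements that
are trivial on some finite set of coordinates, and it contains each factor since
it meets that factor in an open subgroup; multiplying finitely many factors in
yields the whole product.

Both counterexamples rest on one remark: a subgroup of the rationals containing
an interval around zero is everything ([rat_interval_generates]).  Hence the
rationals with the usual topology are TA, while the subgroup of the integers is
discrete and nontrivial, so not TA.

For the quotient of a SMOG group, take the finitely supported sequences of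
rationals, written as polynomials, with the coarsest group topology that refines
pointwise convergence to discrete rationals and makes the sum of the
coefficients, p |-> p(1), continuous for the usual topology.  The polynomials
divisible by X^n form open subgroups with trivial intersection, so this group
has SMOG.  Let N be the closed subgroup p(1) = 0.  Since N is dense for pointwise
convergence, only the second constraint survives modulo N: the quotient is the
group of rationals with its usual topology, a nontrivial TA group, and such a
group cannot have SMOG. *)

Set Implicit Arguments.
Unset Strict Implicit.
Unset Printing Implicit Defensive.

Import Order.TTheory GRing.Theory Num.Theory.
Local Open Scope classical_set_scope.
Local Open Scope group_scope.
Local Open Scope quotient_scope.

(** * Subgroups along homomorphisms *)

Section Morphisms.
Context {G H : groupType} {f : G -> H} (fM : {morph f : x y / x * y}).

Lemma morph_1 : f 1 = 1.
Proof. by apply: (mulgI (f 1)); rewrite -fM !mulg1. Qed.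

Lemma morph_div x y : f (x / y) = f x / f y.
Proof. by apply: (mulIg (f y)); rewrite -fM !mulgVK. Qed.

Fact preim_group_closed (K : subgroup H) : group_closed [in f @^-1` K].
Proof.
split; first by rewrite inE /= morph_1; exact/set_mem/subgroup1.
move=> x y; rewrite !inE /= morph_div => Kx Ky.
by apply/set_mem/subgroupF; exact/mem_set.
Qed.

Definition preim_subgroup (K : subgroup H) := Subgroup (preim_group_closed K).

Fact image_group_closed (K : subgroup G) : group_closed [in f @` K].
Proof.
split; first by rewrite inE; exists 1; [exact/set_mem/subgroup1|exact: morph_1].
move=> _ _ /set_mem[x Kx <-] /set_mem[y Ky <-]; rewrite inE.
exists (x / y); last exact: morph_div.
by apply/set_mem/subgroupF; exact/mem_set.
Qed.

Definition image_subgroup (K : subgroup G) := Subgroup (image_group_closed K).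

End Morphisms.

Section OpenMorphisms.
Context {G H : topologicalGroupType} {f : G -> H}.
Hypothesis fM : {morph f : x y / x * y}.

Lemma open_preim_subgroup (K : subgroup H) :
  continuous f -> open (K : set H) -> open (preim_subgroup fM K : set G).
Proof. by move=> /continuousP; apply. Qed.

End OpenMorphisms.

Lemma TAP (G : topologicalGroupType) :
  TA G <-> forall H : subgroup G, open (H : set G) -> forall x, (H : set G) x.
Proof.
split=> [TAG H oH x|TAG [H [oH [_ nH]]]]; last by apply: nH => x _; exact: TAG.
apply: contrapT => nHx; apply: TAG; exists H; split=> //.
by split=> // /(_ x I).
Qed.

Lemma SMOGP (G : topologicalGroupType) :
  SMOG G <->
  forall x : G,
    (forall H : subgroup G, open (H : set G) -> (H : set G) x) -> x = 1.
Proof.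
split=> [smog x Hx|sep].
  suff : [set 1 : G] x by [].
  by rewrite -smog => H oH; exact: Hx.
apply/seteqP; split=> [x Hx|_ -> H _]; last exact/set_mem/subgroup1.
by apply: sep => H oH; exact: Hx.
Qed.

(** * Permanence properties *)

(** The hypothesis on filters says that the topology of [G] at 1 is the initial
one.  Stating it with filters covers subgroups and products at once: the sets
containing an open subgroup form a filter, and that filter contains the
preimages of neighborhoods of 1, so it contains every neighborhood of 1. *)
Lemma TNA_initial (I : Type) (G : topologicalGroupType)
    (K : I -> topologicalGroupType) (f : forall i, G -> K i) :
  (forall i, {morph f i : x y / x * y}) -> (forall i, continuous (f i)) ->
  (forall F : set_system G, Filter F ->
     (forall i (U : set (K i)), nbhs 1 U -> F (f i @^-1` U)) ->
     F --> (1 : G)) ->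
  (forall i, TNA (K i)) -> TNA G.
Proof.
move=> fM fc init TNAK.
pose F : set_system G := fun U =>
  exists H : subgroup G, open (H : set G) /\ (H : set G) `<=` U.
have FF : Filter F.
  split.
  - exists (Subgroup (subgroup_set := setT)
      (conj (mem_set Logic.I) (fun _ _ _ _ => mem_set Logic.I))).
    by split=> //; exact: openT.
  - move=> U V [A [oA AU]] [B [oB BV]].
    have gAB : group_closed [in (A : set G) `&` (B : set G)].
      split; first by rewrite inE; split; exact/set_mem/subgroup1.
      move=> x y; rewrite !inE => -[Ax Bx] [Ay By].
      by split; apply/set_mem/subgroupF; exact/mem_set.
    exists (Subgroup gAB); split; first exact: openI.
    by move=> x [Ax Bx]; split; [exact: AU|exact: BV].
  - by move=> U V UV [A [oA AU]]; exists A; split=> //; exact: subset_trans UV.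
apply: (init F) => i U /TNAK[A [oA AU]].
exists (preim_subgroup (fM i) A); split; first exact: open_preim_subgroup.
by move=> x; exact: AU.
Qed.

Lemma TNA_open_image (G H : topologicalGroupType) (f : G -> H) :
  {morph f : x y / x * y} -> continuous f ->
  (forall x A, nbhs x A -> nbhs (f x) (f @` A)) -> TNA G -> TNA H.
Proof.
move=> fM fc fo TNAG U; rewrite -(morph_1 fM) => /fc /TNAG[K [oK KU]].
exists (image_subgroup fM K); split; last by move=> _ [x Kx <-]; exact: KU.
rewrite openE => _ [x Kx <-]; apply: fo.
exact: open_nbhs_nbhs.
Qed.

(** An element lying in every open subgroup of [G] is sent by each [f i] into
every open subgroup of [K i], because preimages are open. *)
Lemma SMOG_separated (I : Type) (G : topologicalGroupType)
    (K : I -> topologicalGroupType) (f : forall i, G -> K i) :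
  (forall i, {morph f i : x y / x * y}) -> (forall i, continuous (f i)) ->
  (forall x, (forall i, f i x = 1) -> x = 1) ->
  (forall i, SMOG (K i)) -> SMOG G.
Proof.
move=> fM fc sep smogK; apply/SMOGP => x Hx; apply: sep => i.
have /SMOGP := smogK i; apply => H oH.
exact: (Hx (preim_subgroup (fM i) H) (open_preim_subgroup (fM i) (fc i) oH)).
Qed.

Lemma TA_image (G H : topologicalGroupType) (f : G -> H) :
  {morph f : x y / x * y} -> continuous f -> (forall y, exists x, f x = y) ->
  TA G -> TA H.
Proof.
move=> fM fc fs /TAP TAG; apply/TAP => K oK y; have [x <-] := fs y.
exact: (TAG (preim_subgroup fM K) (open_preim_subgroup fM fc oK)).
Qed.

Section Quotients.
Context {G : topologicalGroupType} (N : closed_normal_subgroup G).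

Lemma pi_morph : {morph (\pi_(quotient_group N) : G -> _) : x y / x * y}.
Proof. by move=> x y; rewrite -pi_mulg. Qed.

Lemma pi_surj (p : quotient_group N) : exists x, \pi x = p.
Proof. by exists (repr p); exact: reprK. Qed.

End Quotients.

Section Subgroups.
Context {G : topologicalGroupType} (H : subgroup G).

Lemma subgroup_val_continuous : continuous (val : subgroup_type H -> G).
Proof. exact: initial_continuous. Qed.

Lemma subgroup_cvg1 (F : set_system (subgroup_type H)) : Filter F ->
  (forall U : set G, nbhs 1 U -> F (val @^-1` U)) ->
  F --> (1 : subgroup_type H).
Proof.
move=> FF F1 U [_ [[B oB <-] B1 BU]].
by apply: filterS BU (F1 _ _); exact: open_nbhs_nbhs.
Qed.

End Subgroups.

Section Products.

Lemma prod_cvg1 (I : Type) (K : I -> topologicalGroupType)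
    (F : set_system (prod_topology K)) : Filter F ->
  (forall i (U : set (K i)), nbhs 1 U -> F [set g | U (g i)]) ->
  F --> (1 : prod_topology K).
Proof.
move=> FF F1; apply/cvg_sup => i U [_ [[B oB <-] B1 BU]].
by apply: filterS BU (F1 _ _ _); exact: open_nbhs_nbhs.
Qed.

Lemma prod_mulgE (I : Type) (K : I -> topologicalGroupType)
  (g h : prod_topology K) i : (g * h) i = g i * h i.
Proof. by []. Qed.

Lemma dfwith1M (I : eqType) (K : I -> topologicalGroupType) i :
  {morph (@dfwith I K (1 : prod_topology K) i : K i -> prod_topology K)
    : x y / x * y}.
Proof.
move=> x y; apply: functional_extensionality_dep => j.
rewrite prod_mulgE; have [->|ij] := eqVneq j i; first by rewrite !dfwithin.
by rewrite !dfwithout 1?eq_sym// mulg1.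
Qed.

(** The index type has decidable equality here so that a single coordinate can
be replaced with [dfwith]; [TA_prod] removes this restriction classically. *)
Lemma TA_prod_eqType (I : eqType) (K : I -> topologicalGroupType) :
  (forall i, TA (K i)) -> TA (prod_topology K).
Proof.
move=> TAK; apply/TAP => H oH.
have H_coord i (x : K i) : (H : set _) (dfwith (1 : prod_topology K) i x).
  have /TAP := TAK i.
  move=> /(_ (preim_subgroup (@dfwith1M I K i) H)); apply.
  by apply: open_preim_subgroup oH; exact: dfwith_continuous.
(* The sets containing all elements that are trivial on some finite list of
   coordinates form a filter to which every neighborhood of 1 belongs. *)
pose F : set_system (prod_topology K) := fun U =>
  exists s : seq I, forall g, {in s, forall i, g i = 1} -> U g.
have FF : Filter F.
  split.
  - by exists [::].
  - move=> U V [s sU] [t tV]; exists (s ++ t) => g g1.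
    by split; [apply: sU|apply: tV] => i si; apply: g1;
      rewrite mem_cat si ?orbT.
  - by move=> U V UV [s sU]; exists s => g /sU; exact: UV.
have [s sH] : F (H : set _).
  apply: (prod_cvg1 FF) (open_nbhs_nbhs _) => [i U U1|].
    exists [:: i] => g /(_ i (mem_head _ _)) /= ->; exact: nbhs_singleton.
  by split=> //; exact/set_mem/subgroup1.
suff HT : forall g : prod_topology K,
    {in [::], forall i : I, g i = 1} -> (H : set _) g.
  by move=> g; exact: HT.
(* Remove the coordinates of the list one at a time: an element trivial on [s]
   is the product of one trivial on [i :: s] and one of the factor [K i]. *)
elim: s sH => // i s IHs sH; apply: IHs => g g1.
pose h : prod_topology K := dfwith g i 1.
have -> : g = h * dfwith (1 : prod_topology K) i (g i).
  apply: functional_extensionality_dep => j.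
  rewrite prod_mulgE /h.
  have [->|ij] := eqVneq j i; first by rewrite !dfwithin mul1g.
  by rewrite !dfwithout 1?eq_sym// mulg1.
apply/set_mem/subgroupM; apply/mem_set; last exact: H_coord.
apply: sH => j; rewrite inE /h; have [->|ij] /= := eqVneq j i.
  by rewrite dfwithin.
by rewrite dfwithout 1?eq_sym//; exact: g1.
Qed.

Lemma TA_prod (I : Type) (K : I -> topologicalGroupType) :
  (forall i, TA (K i)) -> TA (prod_topology K).
Proof. exact: (@TA_prod_eqType {classic I} K). Qed.

End Products.

(** * Abelian groups topologized by a sequence of neighborhoods of zero *)

(** A countable base of neighborhoods of 0 for a Hausdorff group topology.
Halving is stated with a difference so that it also gives, at the cost of a shift
of the index, symmetry and monotonicity ([gaugeN], [gaugeS]). *)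
Record gauge (V : zmodType) := Gauge {
  gauge_set :> nat -> set V ;
  gauge0 : forall n, gauge_set n 0%R ;
  gaugeB : forall n x y,
    gauge_set n.+1 x -> gauge_set n.+1 y -> gauge_set n (x - y)%R ;
  gauge_separated : forall x, (forall n, gauge_set n x) -> x = 0%R ;
}.

Definition gauge_group (V : zmodType) (B : gauge V) : Type :=
  Algebra.to_multiplicative V.

Section GaugeTheory.
Local Open Scope ring_scope.
Context {V : zmodType} (B : gauge V).
Local Notation G := (gauge_group B).

Lemma gaugeS n x : B n.+1 x -> B n x.
Proof. by move=> /gaugeB/(_ (gauge0 _ _)); rewrite subr0. Qed.

Lemma gauge_le m n x : (m <= n)%N -> B n x -> B m x.
Proof.
move=> /subnK <-; elim: (n - m)%N => [//|k IHk].
by rewrite addSn => /gaugeS.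
Qed.

Lemma gaugeN n x : B n.+1 x -> B n (- x).
Proof. by move=> /(gaugeB (gauge0 _ _)); rewrite sub0r. Qed.

Lemma gaugeD n x y : B n.+2 x -> B n.+2 y -> B n (x + y).
Proof. by move=> /gaugeS Bx /gaugeN /(gaugeB Bx); rewrite opprK. Qed.

HB.instance Definition _ := Group.on G.

Lemma gauge_mulgE (x y : G) : (x * y)%g = (x : V) + y :> V.
Proof. by []. Qed.

Lemma gauge_invgE (x : G) : (x^-1)%g = - (x : V) :> V.
Proof. by []. Qed.

Lemma gauge_oneE : 1%g = 0 :> G.
Proof. by []. Qed.

Definition gauge_nbhs (x : G) : set_system G :=
  [set A | exists n, forall y : V, B n (y - x) -> A y].

HB.instance Definition _ := hasNbhs.Build G gauge_nbhs.

Fact gauge_nbhs_filter (x : G) : ProperFilter (nbhs x).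
Proof.
split; first by move=> [n /(_ x)]; rewrite subrr; apply; exact: gauge0.
split.
- by exists 0%N.
- move=> U W [m mU] [n nW]; exists (maxn m n) => y By.
  by split; [apply: mU|apply: nW]; apply: gauge_le By;
    rewrite ?leq_maxl ?leq_maxr.
- by move=> U W UW [n nU]; exists n => y /nU; exact: UW.
Qed.

Fact gauge_nbhs_singleton (x : G) A : nbhs x A -> A x.
Proof. by move=> [n]; apply; rewrite subrr; exact: gauge0. Qed.

Fact gauge_nbhs_nbhs (x : G) A : nbhs x A -> nbhs x (nbhs^~ A).
Proof.
move=> [n nA]; exists n.+2 => y Byx; exists n.+2 => z Bzy.
by apply: nA; rewrite -(subrKA y); exact: gaugeD.
Qed.

HB.instance Definition _ := Nbhs_isNbhsTopological.Build G
  gauge_nbhs_filter gauge_nbhs_singleton gauge_nbhs_nbhs.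

Fact gauge_mulg_continuous :
  continuous (fun x : G * G => (x.1 * x.2)%g).
Proof.
move=> [x y] U [n nU].
exists ([set z : G | B n.+2 (z - x)],
        [set z : G | B n.+2 (z - y)]).
  by split; exists n.+2.
move=> [z t] /= [Bz Bt]; apply: nU.
by rewrite !gauge_mulgE opprD addrACA; exact: gaugeD.
Qed.

Fact gauge_invg_continuous : continuous (fun x : G => x^-1%g).
Proof.
move=> x U [n nU]; exists n.+1 => z Bz; apply: nU.
by rewrite !gauge_invgE -opprD; exact: gaugeN.
Qed.

Fact gauge_hausdorff : hausdorff_space G.
Proof.
move=> x y xy; apply: subr0_eq; apply: (@gauge_separated _ B) => n.
have [||z [zx zy]] := xy [set z | B n.+1 (z - x)] [set z | B n.+1 (z - y)].
- by exists n.+1.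
- by exists n.+1.
rewrite -(subrKA (z : V)) addrC -(opprB (z : V) x).
by apply: gaugeB => //; exact: zx.
Qed.

HB.instance Definition _ :=
  PreTopologicalGroup_isTopologicalGroup.Build G
    gauge_mulg_continuous gauge_invg_continuous gauge_hausdorff.

Lemma gauge_openP (A : set G) :
  open A <-> forall x : V, A x -> exists n, forall y : V, B n (y - x) -> A y.
Proof. by rewrite openE; split=> + x Ax => /(_ x Ax). Qed.

Lemma gauge_open_subgroup (H : subgroup G) n :
  (forall x : V, B n x -> (H : set G) x) -> open (H : set G).
Proof.
move=> BH; apply/gauge_openP => x Hx; exists n => y /BH /mem_set Hyx.
rewrite -(subrK x y); apply/set_mem.
exact: subgroupM Hyx (mem_set Hx).
Qed.

End GaugeTheory.

(** * Rational numbers *)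

Section Rationals.
Local Open Scope ring_scope.

Lemma half_expn_small (e : rat) : 0 < e -> exists n, 2^-1 ^+ n < e.
Proof.
move=> e0; exists (Num.bound e^-1).
rewrite exprVn invf_plt ?posrE ?exprn_gt0//.
have /lt_trans := archi_boundP (ltW (etrans (invr_gt0 e) e0)); apply.
by rewrite -natrX ltr_nat ltn_expl.
Qed.

Lemma half_expn_center n : `|0 : rat| < 2^-1 ^+ n.
Proof. by rewrite normr0 exprn_gt0// invr_gt0. Qed.

Lemma half_expn_split n (x y : rat) :
  `|x| < 2^-1 ^+ n.+1 -> `|y| < 2^-1 ^+ n.+1 -> `|x - y| < 2^-1 ^+ n.
Proof.
move=> xn yn; apply: le_lt_trans (ler_normB _ _) _.
by rewrite [ltRHS]splitr -exprSr ltrD.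
Qed.

Lemma half_expn_separated (x : rat) : (forall n, `|x| < 2^-1 ^+ n) -> x = 0.
Proof.
move=> xs; apply/eqP; rewrite -normr_le0 leNgt; apply/negP.
by move=> /half_expn_small[n /lt_trans /(_ (xs n))]; rewrite ltxx.
Qed.

(** By the Archimedean property, [x] is a multiple of some [x / k] lying in the
interval. *)
Lemma rat_interval_generates (S : set rat) n :
  S 0 -> (forall x y, S x -> S y -> S (x + y)) ->
  (forall x, `|x| < 2^-1 ^+ n -> S x) -> forall x, S x.
Proof.
move=> S0 SD Sn x.
pose k := (Num.bound (`|x| * 2 ^+ n)).+1.
have k0 : 0 < k%:R :> rat by rewrite ltr0n.
rewrite -(divfK (lt0r_neq0 k0) x) mulr_natr.
have Sxk : S (x / k%:R).
  apply: Sn; rewrite normrM normfV (gtr0_norm k0) exprVn.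
  rewrite ltr_pdivrMr// mulrC ltr_pdivlMr ?exprn_gt0//.
  have := archi_boundP (mulr_ge0 (normr_ge0 x) (exprn_ge0 n (ler0n rat 2))).
  by move=> /lt_trans; apply; rewrite ltr_nat.
elim: (k) (x / k%:R) Sxk => [|m IHm] y Sy; first by rewrite mulr0n.
by rewrite mulrS; apply: SD => //; exact: IHm.
Qed.

Definition rat_gauge : gauge rat := @Gauge rat
  (fun n => [set x | `|x| < 2^-1 ^+ n])
  half_expn_center half_expn_split half_expn_separated.

Notation ratT := (gauge_group rat_gauge).

Lemma TA_rat : TA ratT.
Proof.
apply/TAP => H /gauge_openP /(_ 0) [|n Hn].
  exact/set_mem/(subgroup1 H).
apply: (@rat_interval_generates (H : set ratT) n).
- exact/set_mem/(subgroup1 H).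
- by move=> x y Hx Hy; exact/set_mem/(subgroupM (mem_set Hx) (mem_set Hy)).
- by move=> x xn; apply: Hn; rewrite /= subr0.
Qed.

Fact int_group_closed :
  group_closed [in [set x : ratT | exists m : int, x = m%:~R :> rat]].
Proof.
split; first by rewrite inE; exists 0.
move=> x y; rewrite !inE => -[m ->] [n ->]; exists (m - n).
by rewrite rmorphB.
Qed.

Definition int_subgroup : subgroup ratT := Subgroup int_group_closed.

(** The interval of radius 1 around 0 contains no other integer, so the trivial
subgroup is open. *)
Lemma not_TA_int : ~ TA (subgroup_type int_subgroup).
Proof.
move=> /TAP TAH.
have g1 : group_closed [in [set 1%g : subgroup_type int_subgroup]].
  split; first by rewrite inE.
  by move=> x y; rewrite !inE => -> ->; rewrite mulgV.
have oS : open [set 1%g : subgroup_type int_subgroup].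
  rewrite openE => _ ->; rewrite /interior.
  have /(@subgroup_val_continuous _ int_subgroup 1%g) :
      nbhs (1%g : ratT) [set x | `|x : rat| < 1].
    by exists 0%N => x; rewrite /= subr0 expr0.
  apply: (@filterS _ (nbhs (1%g : subgroup_type int_subgroup))).
  move=> [x xZ] /= x1; apply: val_inj => /=.
  move: xZ x1 => /set_mem[m ->]; rewrite -intr_norm ltrz1 => m1.
  by rewrite (_ : m = 0) ?mulr0z//; apply/eqP; rewrite -normr_le0 -ltzD1.
have int1 : (1 : rat) \in (int_subgroup : set ratT) by rewrite inE; exists 1.
have := TAH (Subgroup g1) oS (Sub (1 : rat) int1).
by move=> /(congr1 val) /eqP; rewrite SubK oner_eq0.
Qed.

(** Polynomials stand for finitely supported sequences of rationals, and the
value at 1 for the sum of the terms. *)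
Definition poly_gauge_set (n : nat) : set {poly rat} :=
  [set p : {poly rat} |
    (forall i, (i < n)%N -> p`_i = 0) /\ `|p.[1]| < 2^-1 ^+ n].

Fact poly_gauge0 n : poly_gauge_set n 0.
Proof.
split=> [i _|]; first by rewrite coef0.
by rewrite horner0; exact: half_expn_center.
Qed.

Fact poly_gaugeB n p q : poly_gauge_set n.+1 p -> poly_gauge_set n.+1 q ->
  poly_gauge_set n (p - q).
Proof.
move=> [p0 p1] [q0 q1]; split=> [i ni|].
  by rewrite coefB p0 ?q0 ?subr0// ltnS ltnW.
by rewrite hornerD hornerN; exact: half_expn_split.
Qed.

Fact poly_gauge_separated p : (forall n, poly_gauge_set n p) -> p = 0.
Proof. by move=> p0; apply/polyP => i; rewrite coef0; apply: (p0 i.+1).1. Qed.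

Definition poly_gauge :=
  @Gauge {poly rat} poly_gauge_set poly_gauge0 poly_gaugeB poly_gauge_separated.

Notation polyT := (gauge_group poly_gauge).

Lemma SMOG_poly : SMOG polyT.
Proof.
apply/SMOGP => p Hp; apply/polyP => i; rewrite coef0.
have gi : group_closed [in [set q : polyT | (q : {poly rat})`_i = 0]].
  split; first by rewrite inE /=; exact: coef0.
  move=> q r; rewrite !inE /= => q0 r0.
  by rewrite gauge_mulgE gauge_invgE coefB q0 r0 subr0.
apply: (Hp (Subgroup gi)).
by apply: (@gauge_open_subgroup _ poly_gauge _ i.+1) => q [q0 _]; exact: q0.
Qed.

Fact root1_group_closed :
  group_closed [in [set p : polyT | (p : {poly rat}).[1] = 0]].
Proof.
split; first by rewrite inE /=; exact: horner0.
move=> q r; rewrite !inE /= => q0 r0.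
by rewrite gauge_mulgE gauge_invgE hornerD hornerN q0 r0 subr0.
Qed.

Definition root1_subgroup : subgroup polyT := Subgroup root1_group_closed.

Fact root1_normal (x y : polyT) :
  x \in (root1_subgroup : set polyT) ->
  (x ^ y)%g \in (root1_subgroup : set polyT).
Proof.
rewrite conjgE => xN; suff -> : (y^-1 * (x * y))%g = x by [].
by rewrite !gauge_mulgE gauge_invgE addrC addrK.
Qed.

Fact root1_closed : closed (root1_subgroup : set polyT).
Proof.
rewrite -[X in closed X]setCK; apply: open_closedC.
apply/gauge_openP => p /= /eqP; rewrite -normr_gt0 => /half_expn_small[n np].
exists n => q [_]; rewrite hornerD hornerN => qp q0; move: qp.
by rewrite q0 sub0r normrN ltNge ltW.
Qed.

Definition root1 : closed_normal_subgroup polyT :=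
  ClosedNormalSubgroup root1_normal root1_closed.

(** Write [N] for [root1].  The preimage [L] of an open subgroup contains [N] and
a basic neighborhood of 0 of index [n].  For a small rational [x], the monomial
[x *: 'X^n] lies in that neighborhood and differs from the constant [x] by an
element of [N]; so [L] contains the small constants, then all constants, then,
adding [N] again, all polynomials. *)
Lemma TA_poly_quotient : TA (quotient_group root1).
Proof.
apply/TAP => H oH.
pose L := preim_subgroup (@pi_morph _ root1) H.
have oL : open (L : set polyT).
  exact: (open_preim_subgroup _ (@quotient_pi_continuous _ root1)).
suff LT : forall p : {poly rat}, (L : set polyT) p.
  by move=> x; have [p <-] := pi_surj x; exact: LT.
have LD p q : (L : set polyT) p -> (L : set polyT) q ->
    (L : set polyT) (p + q : {poly rat}).
  by move=> Lp Lq; exact/set_mem/(subgroupM (mem_set Lp) (mem_set Lq)).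
have NL p : p.[1] = 0 -> (L : set polyT) p.
  move=> p0; rewrite /L /=.
  suff -> : \pi_(quotient_group root1) (p : polyT) = 1%g.
    exact/set_mem/subgroup1.
  apply/esym/quotientP; rewrite /coset_eq inE /=.
  by rewrite gauge_mulgE gauge_invgE gauge_oneE oppr0 add0r.
have [|n Ln] := (gauge_openP (L : set polyT)).1 oL 0.
- exact/set_mem/(subgroup1 L).
have L_const : forall c : rat, (L : set polyT) c%:P.
  apply: (@rat_interval_generates (fun c => (L : set polyT) c%:P) n).
  - exact: (NL _ (horner0 _)).
  - by move=> x y Lx Ly; rewrite polyCD; exact: LD.
  - move=> x xn; rewrite -(subrK (x *: 'X^n) x%:P); apply: LD.
      by apply: NL; rewrite !hornerE expr1n mulr1 subrr.
    apply: Ln; rewrite subr0; split=> [i ni|].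
      by rewrite coefZ coefXn ltn_eqF// mulr0.
    by rewrite !hornerE expr1n mulr1.
move=> p; rewrite -(subrK p.[1]%:P p); apply: LD; last exact: L_const.
by apply: NL; rewrite !hornerE subrr.
Qed.

(** The class of ['X] lies in every open subgroup by [TA_poly_quotient], and it is
nontrivial since the value at 1 of that polynomial is 1. *)
Lemma not_SMOG_poly_quotient : ~ SMOG (quotient_group root1).
Proof.
move=> /SMOGP /(_ (\pi_(quotient_group root1) ('X : polyT))) X1.
have /quotientP : \pi_(quotient_group root1) ('X : polyT) =
    \pi_(quotient_group root1) (1%g : polyT).
  by apply: X1 => H oH; exact: (TAP _).1 TA_poly_quotient H oH _.
rewrite coset_eq_sym /coset_eq inE /=.
rewrite gauge_mulgE gauge_invgE gauge_oneE oppr0 add0r hornerX.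
by move/eqP; rewrite oner_eq0.
Qed.

End Rationals.

(** * The permanence properties and their failures *)

Theorem proposition2p3 :
  ((forall (G : topologicalGroupType) (H : subgroup G),
      TNA G -> TNA (subgroup_type H)) /\
   (forall (G : topologicalGroupType) (N : closed_normal_subgroup G),
      TNA G -> TNA (quotient_group N)) /\
   (forall (I : Type) (K : I -> topologicalGroupType),
      (forall i, TNA (K i)) -> TNA (prod_topology K)))
  /\
  ((forall (G : topologicalGroupType) (H : subgroup G),
      SMOG G -> SMOG (subgroup_type H)) /\
   (forall (I : Type) (K : I -> topologicalGroupType),
      (forall i, SMOG (K i)) -> SMOG (prod_topology K)) /\
   (exists (G : topologicalGroupType) (N : closed_normal_subgroup G),
      SMOG G /\ ~ SMOG (quotient_group N)))
  /\
  ((forall (G : topologicalGroupType) (N : closed_normal_subgroup G),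
      TA G -> TA (quotient_group N)) /\
   (forall (I : Type) (K : I -> topologicalGroupType),
      (forall i, TA (K i)) -> TA (prod_topology K)) /\
   (exists (G : topologicalGroupType) (H : subgroup G),
      TA G /\ ~ TA (subgroup_type H))).
Proof.
split; [split; [|split]|split; [split; [|split]|split; [|split]]].
- move=> G H TNAG.
  apply: (@TNA_initial unit (subgroup_type H) (fun=> G) (fun=> val))
    => [_ x y //|_||//].
    exact: subgroup_val_continuous.
  by move=> F FF F1; apply: subgroup_cvg1 => U; exact: F1 tt U.
- move=> G N; apply: TNA_open_image (@pi_morph G N) _ _.
    exact: quotient_pi_continuous.
  exact: quotient_pi_nbhs.
- move=> I K; apply: (@TNA_initial _ (prod_topology K) K (fun i g => g i))
    => //.
    by move=> i; exact: prod_proj_continuous.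
  by move=> F FF F1; exact: prod_cvg1.
- move=> G H smogG.
  apply: (@SMOG_separated unit (subgroup_type H) (fun=> G) (fun=> val))
    => [_ x y //|_||//].
    exact: subgroup_val_continuous.
  by move=> x /(_ tt) x1; exact: val_inj.
- move=> I K; apply: (@SMOG_separated _ (prod_topology K) K (fun i g => g i))
    => //.
    by move=> i; exact: prod_proj_continuous.
  by move=> g g1; apply: functional_extensionality_dep.
- exists (gauge_group poly_gauge), root1.
  by split; [exact: SMOG_poly|exact: not_SMOG_poly_quotient].
- move=> G N; apply: TA_image (@pi_morph G N) _ _; last exact: pi_surj.
  exact: quotient_pi_continuous.
- exact: TA_prod.
- exists (gauge_group rat_gauge), int_subgroup.
  by split; [exact: TA_rat|exact: not_TA_int].
Qed.
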